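(* For every $q\in\mathbb{Z}$, the Block Lie algebra $\mathcal{B}(q)$ admits a non-trivial $\mathrm{Hom}$-Lie algebra structure.
   Context: All algebras are over $\mathbb{C}$ and all linear maps are $\mathbb{C}$-linear. For $q\in\mathbb{C}$, the Block Lie algebra $\mathcal{B}(q)$ is the complex Lie algebra with basis $\{L_{m,i}\mid m,i\in\mathbb{Z}\}$ and bracket $[L_{m,i},L_{n,j}]=(n(i+q)-m(j+q))L_{m+n,i+j}$. A $\mathrm{Hom}$-Lie structure on a Lie algebra $(\mathfrak{L},[\cdot,\cdot])$ is a linear map $\varphi:\mathfrak{L}\to\mathfrak{L}$ such that $[\varphi(x),[y,z]]+[\varphi(y),[z,x]]+[\varphi(z),[x,y]]=0$ for all $x,y,z\in\mathfrak{L}$. It is non-trivial if $\varphi$ is not a scalar multiple of the identity map (in particular $\varphi\neq0$). *)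

(* Defs.v *)
From HB Require Import structures.
From mathcomp Require Import all_boot all_order all_algebra.
From mathcomp Require Import finmap ring.
From mathcomp.multinomials Require Import monalg.

Set Implicit Arguments.
Unset Strict Implicit.
Unset Printing Implicit Defensive.

Import GRing.Theory.
Local Open Scope ring_scope.

HB.mixin Record Lmodule_isLieAlgebra (K : fieldType) L of GRing.Lmodule K L := {
  lie : L -> L -> L;
  lie_linearl : forall (a : K) (x y z : L),
    lie (a *: x + y) z = a *: lie x z + lie y z;
  lie_linearr : forall (a : K) (x y z : L),
    lie x (a *: y + z) = a *: lie x y + lie x z;
  liexx : forall x : L, lie x x = 0;
  lie_jacobi : forall x y z : L,
    lie x (lie y z) + lie y (lie z x) + lie z (lie x y) = 0
}.

#[short(type="lieAlgType")]
HB.structure Definition LieAlgebra (K : fieldType) :=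
  { L of GRing.Lmodule K L & Lmodule_isLieAlgebra K L }.

Definition hom_lie_structure (K : fieldType) (L : lieAlgType K)
    (phi : {linear L -> L}) : Prop :=
  forall x y z : L,
    lie (phi x) (lie y z) + lie (phi y) (lie z x) + lie (phi z) (lie x y) = 0.

Definition hom_lie_trivial (K : fieldType) (L : lieAlgType K)
    (phi : {linear L -> L}) : Prop :=
  exists c : K, forall x : L, phi x = c *: x.

(* The carrier does not mention q, which only serves to select the bracket:
   this is the free K-module on the pairs (m, i) of integers. *)
Definition block (K : fieldType) (q : K) : Type := {malg K[(int * int)%type]}.

HB.instance Definition _ (K : fieldType) (q : K) :=
  GRing.Lmodule.copy (block q) {malg K[(int * int)%type]}.

Definition block_basis (K : fieldType) (q : K) (m i : int) : block q :=
  << (m, i) >>.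

Definition block_coef (K : fieldType) (q : K) (a b : int * int) : K :=
  b.1%:~R * (a.2%:~R + q) - a.1%:~R * (b.2%:~R + q).

Definition block_lie (K : fieldType) (q : K) (x y : block q) : block q :=
  \sum_(a <- msupp x) \sum_(b <- msupp y)
    (x@_a * y@_b * block_coef q a b) *: block_basis q (a.1 + b.1) (a.2 + b.2).

Section BilinearExtension.
Variables (K : fieldType) (L : lmodType K) (br : L -> L -> L).
Hypothesis brl : forall (c : K) x y z, br (c *: x + y) z = c *: br x z + br y z.
Hypothesis brC : forall x y, br x y = - br y x.
Variables (I : Type) (e : I -> L).
Hypothesis e_span : forall P : L -> Prop, P 0 ->
  (forall c a x, P x -> P (c *: e a + x)) -> forall x, P x.

Let brr (c : K) x y z : br x (c *: y + z) = c *: br x y + br x z.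
Proof. by rewrite brC brl opprD -scalerN -!(brC x). Qed.

Let br0 x : br 0 x = 0.
Proof. by have := brl (- 1) 0 0 x; rewrite scaler0 add0r scaleN1r addNr. Qed.

Let brx0 x : br x 0 = 0.
Proof. by rewrite brC br0 oppr0. Qed.

Lemma alternating_ext : (forall a, br (e a) (e a) = 0) -> forall x, br x x = 0.
Proof.
move=> bree; elim/e_span => [|c a x IHx]; first exact: br0.
by rewrite brl !brr IHx addr0 bree scaler0 add0r (brC x) scalerN subrr.
Qed.

Lemma jacobi_ext :
    (forall a b c, br (e a) (br (e b) (e c)) + br (e b) (br (e c) (e a)) +
       br (e c) (br (e a) (e b)) = 0) ->
  forall x y z, br x (br y z) + br y (br z x) + br z (br x y) = 0.
Proof.
pose J u v w := br u (br v w) + br v (br w u) + br w (br u v).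
move=> Je x y z; rewrite -/(J x y z).
have JC u v w : J u v w = J v w u by rewrite /J [RHS]addrC addrA.
have J0 v w : J 0 v w = 0 by rewrite /J !(br0, brx0) !addr0.
have JD c u u' v w : J (c *: u + u') v w = c *: J u v w + J u' v w.
  rewrite /J !(brl, brr) !scalerDr [RHS]addrACA; congr (_ + _).
  by rewrite addrACA.
elim/e_span: x => [|c a x IHx]; first exact: J0.
rewrite JD {}IHx addr0 JC [J _ _ _](_ : _ = 0) ?scaler0 //.
elim/e_span: y => [|d b y IHy]; first exact: J0.
rewrite JD {}IHy addr0 JC [J _ _ _](_ : _ = 0) ?scaler0 //.
elim/e_span: z => [|f g z IHz]; first exact: J0.
by rewrite JD IHz addr0 [J _ _ _]Je scaler0.
Qed.

End BilinearExtension.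

Section BlockLie.
Variables (K : fieldType) (q : K).
Local Notation B := (block q).
Local Notation br := (@block_lie K q).
Local Notation e a := (block_basis q a.1 a.2).

Local Open Scope fset_scope.
Local Open Scope ring_scope.

Lemma block_lieEw (d1 d2 : {fset int * int}) (x y : B) :
  msupp x `<=` d1 -> msupp y `<=` d2 ->
  br x y = \sum_(a <- d1) \sum_(b <- d2)
    (x@_a * y@_b * block_coef q a b) *: block_basis q (a.1 + b.1) (a.2 + b.2).
Proof.
move=> le_d1 le_d2; rewrite /block_lie (big_fset_incl _ le_d1) /=.
  apply/eq_bigr=> a _; apply/big_fset_incl => // b _ /mcoeff_outdom ->.
  by rewrite mulr0 mul0r scale0r.
move=> a _ /mcoeff_outdom xa.
by rewrite big1 // => b _; rewrite xa !mul0r scale0r.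
Qed.

Lemma block_lie_linearl (c : K) (x y z : B) :
  br (c *: x + y) z = c *: br x z + br y z.
Proof.
pose d := msupp x `|` msupp y `|` msupp (c *: x + y).
have sx : msupp x `<=` d by apply/fsubsetP => k kx; rewrite !in_fsetU kx.
have sy : msupp y `<=` d by apply/fsubsetP => k ky; rewrite !in_fsetU ky orbT.
have sxy : msupp (c *: x + y) `<=` d by apply: fsubsetUr.
have sz := fsubset_refl (msupp z).
rewrite (block_lieEw sx sz) (block_lieEw sy sz) (block_lieEw sxy sz).
rewrite scaler_sumr -big_split /=; apply: eq_bigr => a _.
rewrite scaler_sumr -big_split /=; apply: eq_bigr => b _.
by rewrite scalerA -scalerDl mcoeffD mcoeffZ; congr (_ *: _); ring.
Qed.

Lemma block_lieC (x y : B) : br x y = - br y x.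
Proof.
rewrite /block_lie exchange_big -sumrN; apply: eq_bigr => a _.
rewrite -sumrN; apply: eq_bigr => b _.
rewrite [b.1 + _]addrC [b.2 + _]addrC -scaleNr; congr (_ *: _).
by rewrite /block_coef; ring.
Qed.

Lemma block_lie_linearr (c : K) (x y z : B) :
  br x (c *: y + z) = c *: br x y + br x z.
Proof.
by rewrite block_lieC block_lie_linearl opprD -scalerN -!(block_lieC x).
Qed.

Lemma block_lie_basis (m i n j : int) :
  br (block_basis q m i) (block_basis q n j) =
  (n%:~R * (i%:~R + q) - m%:~R * (j%:~R + q)) *: block_basis q (m + n) (i + j).
Proof.
rewrite (@block_lieEw [fset (m, i)] [fset (n, j)]) ?msuppU_le //.
by rewrite !big_seq_fset1 /= !mcoeffUU !mul1r.
Qed.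

Lemma block_span (P : B -> Prop) : P 0 ->
  (forall c a (x : B), P x -> P (c *: e a + x)) -> forall x, P x.
Proof.
move=> P0 PD x; rewrite (monalgE x).
elim: (X in \sum_(_ <- X) _) => [|a s IHs]; first by rewrite big_nil.
rewrite big_cons; suff -> : << x@_a *g a >> = x@_a *: e a :> B by exact: PD.
by apply/malgP => k; rewrite mcoeffZ !mcoeffU -surjective_pairing mulr_natr.
Qed.

Fact block_liexx (x : B) : br x x = 0.
Proof.
apply: (alternating_ext block_lie_linearl block_lieC block_span) => a.
by rewrite block_lie_basis subrr scale0r.
Qed.

Fact block_lie_jacobi (x y z : B) :
  br x (br y z) + br y (br z x) + br z (br x y) = 0.
Proof.
apply: (jacobi_ext block_lie_linearl block_lieC block_span) => a b c.
have brZ k u v : br u (k *: v) = k *: br u v.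
  have lie0 : br u 0 = 0.
    by rewrite block_lieC /block_lie msupp0 big_seq_fset0 oppr0.
  by have := block_lie_linearr k u v 0; rewrite lie0 !addr0.
rewrite !block_lie_basis !brZ !block_lie_basis !scalerA.
rewrite [b.1 + (c.1 + a.1)]addrCA [b.1 + a.1]addrC.
rewrite [b.2 + (c.2 + a.2)]addrCA [b.2 + a.2]addrC.
rewrite [a.1 + (b.1 + c.1)]addrA [a.2 + (b.2 + c.2)]addrA.
rewrite [a.1 + b.1 + c.1]addrC [a.2 + b.2 + c.2]addrC.
rewrite -!scalerDl [X in X *: _](_ : _ = 0) ?scale0r //.
by rewrite !rmorphD /=; ring.
Qed.

HB.instance Definition _ := Lmodule_isLieAlgebra.Build K B
  block_lie_linearl block_lie_linearr block_liexx block_lie_jacobi.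

End BlockLie.

(* Main.v *)
(* [L_{0,-q}] is central in the Block algebra, and a linear map with central
   image makes every term of the Hom-Jacobi identity vanish; so the rank-one
   map [L_{1,0} |-> L_{0,-q}], zero on the other basis vectors, works. *)
From HB Require Import structures.
Require Import Defs.
From mathcomp Require Import all_boot all_order all_algebra.
From mathcomp Require Import reals complex.
From mathcomp Require Import finmap.
From mathcomp.multinomials Require Import monalg.
Import GRing.Theory.
Local Open Scope ring_scope.

Lemma lie0l (K : fieldType) (L : lieAlgType K) (y : L) : lie 0 y = 0.
Proof.
by have := lie_linearl (- 1) 0 0 y; rewrite scaler0 addr0 scaleN1r addNr.
Qed.

Lemma lieZl (K : fieldType) (L : lieAlgType K) (c : K) (x y : L) :
  lie (c *: x) y = c *: lie x y.
Proof. by have := lie_linearl c x 0 y; rewrite lie0l !addr0. Qed.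

Lemma hom_lie_structure_central (K : fieldType) (L : lieAlgType K)
    (phi : {linear L -> L}) :
  (forall x y, lie (phi x) y = 0) -> hom_lie_structure phi.
Proof. by move=> phiZ x y z; rewrite !phiZ !addr0. Qed.

(** The coefficient of $[L_{0,-q}, L_{n,j}]$ is $n(-q+q) - 0\cdot(j+q)$, and both terms vanish.
    Integrality of [q] is what makes [- q] an admissible index. *)
Lemma block_lie_central (K : fieldType) (q : int) (y : block (q%:~R : K)) :
  lie (block_basis (q%:~R : K) 0 (- q)) y = 0.
Proof.
rewrite [LHS]/(block_lie _ _) /block_lie big1_seq // => a /=.
(* The support of a basis vector lies in a singleton, so only [a = (0, - q)] has to be checked. *)
move=> /(fsubsetP msuppU_le); rewrite in_fset1 => /eqP ->.
rewrite big1 // => b _; rewrite /block_coef /= mulrNz addNr mulr0 mul0r subrr.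
by rewrite mulr0 scale0r.
Qed.

Section RankOne.
Variables (K : fieldType) (q : K) (a : int * int) (v : block q).

Definition block_rank1 (x : block q) : block q := x@_a *: v.

Fact block_rank1_linear : linear block_rank1.
Proof.
by move=> c x y; rewrite /block_rank1 mcoeffD mcoeffZ scalerDl scalerA.
Qed.

HB.instance Definition _ :=
  GRing.isLinear.Build K (block q) (block q) *:%R block_rank1
    block_rank1_linear.

End RankOne.

Theorem corollary2p13 (R : realType) (q : int) :
  exists phi : {linear block (q%:~R : R[i]) -> block (q%:~R : R[i])},
    hom_lie_structure phi /\ ~ hom_lie_trivial phi.
Proof.
exists (block_rank1 R[i] q%:~R (1, 0) (block_basis (q%:~R : R[i]) 0 (- q))).
split.
  apply: hom_lie_structure_central => x y.
  by rewrite lieZl block_lie_central scaler0.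
(* At $L_{1,0}$ triviality would give $L_{0,-q} = c L_{1,0}$. The coefficients at [(0, - q)] are 1
   and 0: the first indices 0 and 1 differ whatever [q] is. *)
case=> c /(_ (block_basis _ 1 0)) /(congr1 (mcoeff (0, - q))).
rewrite /= /block_rank1 !mcoeffZ !mcoeffU /= !eqxx /=.
by rewrite mulr1 mulr0 => /eqP; rewrite oner_eq0.
Qed.
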